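(* Let $E$ be a pseudo effect algebra satisfying (RDP)$_2$ and let $s$ be a state on $E$. Then there is a unique regular Borel probability measure $\mu_s$ on $\mathcal B(\mathcal S(E))$ such that $\mu_s(\partial_e\mathcal S(E))=1$ and $$s(a)=\int_{\partial_e\mathcal S(E)}\hat a(x)\,\mathrm d\mu_s(x),\qquad a\in E.$$
   Context: A pseudo effect algebra is a partial algebra $(E;+,0,1)$, with $+$ a partial binary operation and $0,1$ constants, such that for all $a,b,c\in E$: (i) $a+b$ and $(a+b)+c$ exist iff $b+c$ and $a+(b+c)$ exist, and then $(a+b)+c=a+(b+c)$; (ii) there are exactly one $d\in E$ and exactly one $e\in E$ with $a+d=e+a=1$; (iii) if $a+b$ exists, there are $d,e\in E$ with $a+b=d+a=b+e$; (iv) if $1+a$ or $a+1$ exists, then $a=0$. The order is $a\le b$ iff there is $c\in E$ with $a+c=b$. (RDP)$_2$: for all $a_1,a_2,b_1,b_2\in E$ with $a_1+a_2=b_1+b_2$ there are $d_1,d_2,d_3,d_4\in E$ with $d_1+d_2=a_1$, $d_3+d_4=a_2$, $d_1+d_3=b_1$, $d_2+d_4=b_2$ and $d_2\wedge d_3=0$. A state on $E$ is a map $s:E\to[0,1]$ with $s(a+b)=s(a)+s(b)$ whenever $a+b$ is defined and $s(1)=1$. $\mathcal S(E)$ is the set of all states, a compact convex Hausdorff space under pointwise (weak) convergence; $\partial_e\mathcal S(E)$ is the set of its extreme points (extremal states). For $a\in E$, $\hat a:\mathcal S(E)\to[0,1]$ is $\hat a(x)=x(a)$. $\mathcal B(K)$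 denotes the Borel $\sigma$-algebra of a compact Hausdorff space $K$; a Borel measure $\mu$ on $K$ is regular if $\inf\{\mu(O): Y\subseteq O,\ O\text{ open}\}=\mu(Y)=\sup\{\mu(C): C\subseteq Y,\ C\text{ closed}\}$ for all $Y\in\mathcal B(K)$. *)

(* Defs.v *)
From HB Require Import structures.
From mathcomp Require Import all_boot all_order all_algebra.
From mathcomp Require Import all_classical all_reals all_analysis.

Set Implicit Arguments.
Unset Strict Implicit.
Unset Printing Implicit Defensive.

Import Order.TTheory GRing.Theory Num.Theory numFieldNormedType.Exports.

Local Open Scope classical_set_scope.
Local Open Scope ring_scope.

(* [peadd a b = Some c] means that [a + b] is defined and equal to [c].
   In [peaddA], an [obind] is [None] as soon as one of its two sums is
   undefined, so the equation says that both sides are defined simultaneously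
   and then agree. *)
HB.mixin Record isPseudoEffectAlgebra E := {
  peadd : E -> E -> option E;
  pea0 : E;
  pea1 : E;
  peaddA : forall a b c : E,
    obind (fun ab => peadd ab c) (peadd a b) =
    obind (fun bc => peadd a bc) (peadd b c);
  pea_complr : forall a : E, exists! d : E, peadd a d = Some pea1;
  pea_compll : forall a : E, exists! e : E, peadd e a = Some pea1;
  peadd_swap : forall a b c : E, peadd a b = Some c ->
    exists d e : E, peadd d a = Some c /\ peadd b e = Some c;
  peadd1_eq0 : forall a : E,
    peadd pea1 a <> None \/ peadd a pea1 <> None -> a = pea0
}.

#[short(type="pseudoEffectAlgebraType")]
HB.structure Definition PseudoEffectAlgebra := {E of isPseudoEffectAlgebra E}.

Section PseudoEffectAlgebraTheory.
Variable E : pseudoEffectAlgebraType.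
Implicit Types a b c m : E.

Definition pea_le a b : Prop := exists c, peadd a c = Some b.

Definition pea_is_meet a b m : Prop :=
  [/\ pea_le m a, pea_le m b &
      forall c, pea_le c a -> pea_le c b -> pea_le c m].

End PseudoEffectAlgebraTheory.

Definition RDP2 (E : pseudoEffectAlgebraType) : Prop :=
  forall a1 a2 b1 b2 c : E,
    peadd a1 a2 = Some c -> peadd b1 b2 = Some c ->
  exists d1 d2 d3 d4 : E,
    [/\ peadd d1 d2 = Some a1, peadd d3 d4 = Some a2,
        peadd d1 d3 = Some b1, peadd d2 d4 = Some b2 &
        pea_is_meet d2 d3 pea0].

Section States.
Variables (R : realType) (E : pseudoEffectAlgebraType).

Definition is_state (s : E -> R) : Prop :=
  [/\ forall a, 0 <= s a <= 1,
      forall a b c, peadd a b = Some c -> s c = s a + s b &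
      s pea1 = 1].

Definition states : set {ptws E -> R} := [set s | is_state s].

(* As a [set_type], [state] carries the topology induced by [{ptws E -> R}],
   i.e., that of pointwise convergence. *)
Definition state : Type := set_type states.

Definition state_eval (a : E) (x : state) : R := set_val x a.

Definition extremal_states : set state :=
  [set x | forall (y z : state) (t : R), 0 < t < 1 ->
    (forall a, state_eval a x =
               t * state_eval a y + (1 - t) * state_eval a z) ->
    y = x /\ z = x].

(* Measurable types are required to be pointed, whereas an algebra may have no
   state: a given state serves as the default point. The topology (hence the
   Borel sigma-algebra) of [state_space s] does not depend on [s]. *)
Definition state_space (s : state) : Type := state.

HB.instance Definition _ (s : state) :=
  Topological.copy (state_space s) (set_type states).
HB.instance Definition _ (s : state) := isPointed.Build (state_space s) s.

End States.

Notation borelType T := (g_sigma_algebraType (@open T)).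

Definition regular_measure (R : realType) (T : ptopologicalType)
    (mu : {measure set (borelType T) -> \bar R}) : Prop :=
  forall Y : set (borelType T), measurable Y ->
    ereal_inf [set mu O | O in [set O : set T | open O /\ Y `<=` O]] = mu Y /\
    ereal_sup [set mu C | C in [set C : set T | closed C /\ C `<=` Y]] = mu Y.

(* [mu] is only meaningful on Borel sets, hence the measurability clause. *)
Definition represents_state (R : realType) (E : pseudoEffectAlgebraType)
    (s : state R E) (mu : probability (borelType (state_space s)) R) : Prop :=
  [/\ regular_measure mu,
      measurable (@extremal_states R E : set (borelType (state_space s))),
      mu (@extremal_states R E) = 1%E &
      forall a : E, (state_eval a s)%:E =
        (\int[mu]_(x in @extremal_states R E) (state_eval a x)%:E)%E].

Arguments represents_state {R E} s mu.

(* Main.v *)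
Require Import Defs.
From HB Require Import structures.
From mathcomp Require Import all_boot all_order all_algebra.
From mathcomp Require Import all_classical all_reals all_analysis.
From mathcomp Require Import measurable_realfun ring lra.

Set Implicit Arguments.
Unset Strict Implicit.
Unset Printing Implicit Defensive.

Import Order.TTheory GRing.Theory Num.Theory numFieldNormedType.Exports.

Local Open Scope classical_set_scope.
Local Open Scope ring_scope.

(** The measure is built on the compact space of all states, and everything
    rests on one description of the extremal states: they are the disjunctive
    ones, i.e. those vanishing at a or at b as soon as the meet of a and b is 0
    ([extremal_statesE]). If x is extremal and x(d) > 0, the part of x carried
    by the ideal generated by d is additive by Riesz decomposition, hence
    proportional to x, and it kills whatever is disjoint from d. Conversely a
    disjunctive state is a homomorphism into [0, 1] with truncated addition, so
    that its kernel determines it, and a state occurring in a proper convex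
    decomposition of it has at least the same kernel. Two consequences: the set
    X of extremal states is closed, and the functions x |-> x(a) on X are
    closed under complement, truncated sum, minimum and the truncations of n
    x(a) - k to [0, 1] ([ev_compl], [ev_oplus], [ev_min], [ev_clamp]). Elements
    of E thus provide Urysohn functions on X ([ev_urysohn]), which makes it
    possible to run the proof of the Riesz representation theorem with elements
    of E instead of continuous functions.

    Integrals over X can only be compared with values at s through inequalities
    valid on X; these transfer to every state by Bauer's minimum principle
    ([bauer_minimum]): a continuous affine function on the states attains its
    minimum at an extremal state.

    Existence. The content of an open set O is the supremum of s(a) over the
    elements a whose function vanishes on X outside O, and the outer measure of
    a set is the infimum of the contents of the open sets containing it.
    Countable subadditivity comes from compactness and Urysohn functions, and
    open sets are Caratheodory measurable because truncated sums are available;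
    this gives a regular Borel probability measure, carried by X since s(a) = 0
    when a vanishes on X. Slicing n a into the truncations of n a - k bounds
    s(a) by the integral of a ([state_le_integral]), and the same bound for the
    complement of a turns it into an equality.

    Uniqueness. If nu also represents s and a vanishes on X outside the open
    set O, then s(a), being the integral of a, is at most nu(O). So the
    constructed measure is below nu on open sets, hence on Borel sets by outer
    regularity of nu, and both have total mass 1 ([represents_state_ge],
    [represents_state_unique]). *)

(** * Partial addition and the ideal generated by an element *)
Section Algebra.
Variable E : pseudoEffectAlgebraType.
Implicit Types a b c d e : E.

Lemma peaddA_r a b c ab u : peadd a b = Some ab -> peadd ab c = Some u ->
  exists2 bc, peadd b c = Some bc & peadd a bc = Some u.
Proof.
move=> hab hu; have := peaddA a b c; rewrite hab /= hu.
by case: (peadd b c) => //= bc /esym ?; exists bc.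
Qed.

Lemma peaddA_l a b c bc u : peadd b c = Some bc -> peadd a bc = Some u ->
  exists2 ab, peadd a b = Some ab & peadd ab c = Some u.
Proof.
move=> hbc hu; have := peaddA a b c; rewrite hbc /= hu.
by case: (peadd a b) => //= ab ?; exists ab.
Qed.

(** Associativity of (a + b) + (c + d): the two inner terms can be added first,
    which is how parts of two summands are put together in [componentD]. *)
Lemma peadd_cross a b c d ab cd u : peadd a b = Some ab ->
  peadd c d = Some cd -> peadd ab cd = Some u ->
  exists bc abc, [/\ peadd b c = Some bc, peadd a bc = Some abc &
                   peadd abc d = Some u].
Proof.
move=> hab hcd hu.
have [abc habc hu'] := peaddA_l hcd hu.
have [bc hbc habc'] := peaddA_r hab habc.
by exists bc, abc.
Qed.

Lemma peadd10 : peadd (pea1 : E) pea0 = Some pea1 /\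
                peadd (pea0 : E) pea1 = Some pea1.
Proof.
have [d [hd _]] := @pea_complr E pea1; have [e [he _]] := @pea_compll E pea1.
have d0 : d = pea0 by apply: peadd1_eq0; left; rewrite hd.
have e0 : e = pea0 by apply: peadd1_eq0; right; rewrite he.
by rewrite -{1}d0 -{1}e0.
Qed.

Lemma peadda0 a : peadd a pea0 = Some a.
Proof.
have [e [he _]] := @pea_compll E a; have [a' [_ ua]] := @pea_complr E e.
have [b hb hb'] := peaddA_r he peadd10.1.
by rewrite hb -(ua _ he) (ua _ hb').
Qed.

Lemma peadd0a a : peadd pea0 a = Some a.
Proof.
have [d [hd _]] := @pea_complr E a; have [a' [_ ua]] := @pea_compll E d.
have [b hb hb'] := peaddA_l hd peadd10.2.
by rewrite hb -(ua _ hd) (ua _ hb').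
Qed.

Lemma pea_le_refl a : pea_le a a. Proof. by exists pea0; exact: peadda0. Qed.

Lemma pea_le0 a : pea_le pea0 a. Proof. by exists a; exact: peadd0a. Qed.

Lemma pea_le_trans a b c : pea_le a b -> pea_le b c -> pea_le a c.
Proof.
by move=> [r hr] [t ht]; have [rt _ ?] := peaddA_r hr ht; exists rt.
Qed.

(** The order is defined with complements on the right; the exchange axiom
    makes left complements equally good. *)
Lemma pea_leE a b : pea_le a b <-> exists c, peadd c a = Some b.
Proof.
split=> [[c /peadd_swap[d [e [? _]]]]|[c /peadd_swap[d [e [_ ?]]]]].
  by exists d.
by exists e.
Qed.

Lemma pea_le_addr a b c : peadd a b = Some c -> pea_le b c.
Proof. by move=> h; apply/pea_leE; exists a. Qed.

Lemma pea_le_addl a b c : peadd a b = Some c -> pea_le a c.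
Proof. by move=> h; exists b. Qed.

(** The finite sums of elements below d; as binary trees, they are closed under
    addition without any appeal to associativity. *)
Inductive pea_ideal d : E -> Prop :=
| pea_ideal_le a : pea_le a d -> pea_ideal d a
| pea_idealD a b c :
    pea_ideal d a -> pea_ideal d b -> peadd a b = Some c -> pea_ideal d c.

Hypothesis hE : RDP2 E.

Lemma RDP2_le_add c a b u : pea_le c u -> peadd a b = Some u ->
  exists c1 c2, [/\ peadd c1 c2 = Some c, pea_le c1 a & pea_le c2 b].
Proof.
move=> [r hr] hab.
have [d1 [d2 [d3 [d4 [h1 _ h3 h4 _]]]]] := hE hr hab.
by exists d1, d2; split => //; [exists d3 | exists d4].
Qed.

(** Riesz decomposition distributes an element below a sum over its summands. *)
Lemma pea_ideal_down d c e : pea_ideal d c -> pea_le e c -> pea_ideal d e.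
Proof.
move=> dc; elim: dc e => {c} [a ad|a b c _ iha _ ihb abc] e ec.
  exact/pea_ideal_le/(pea_le_trans ec).
have [e1 [e2 [h12 h1 h2]]] := RDP2_le_add ec abc.
exact: pea_idealD (iha _ h1) (ihb _ h2) h12.
Qed.

End Algebra.

(** * Extremal states are disjunctive *)
Section Facts.
Variables (R : realType) (E : pseudoEffectAlgebraType).
Implicit Types (a b c d : E) (x y z : state R E).

Local Notation ev := (@state_eval R E).

Lemma stateP x : is_state (set_val x).
Proof. by have := set_valP x. Qed.

Lemma stateD x a b c : peadd a b = Some c -> ev c x = ev a x + ev b x.
Proof. by have [_ h _] := stateP x; exact: h. Qed.

Lemma state_ge0 x a : 0 <= ev a x.
Proof. by have [/(_ a)/andP[]] := stateP x. Qed.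

Lemma state_le1 x a : ev a x <= 1.
Proof. by have [/(_ a)/andP[]] := stateP x. Qed.

Lemma state1 x : ev pea1 x = 1.
Proof. by have [] := stateP x. Qed.

Lemma state0 x : ev pea0 x = 0.
Proof.
by apply: (addrI (ev pea0 x)); rewrite -(stateD _ (peadd0a _)) addr0.
Qed.

Lemma state_le x a b : pea_le a b -> ev a x <= ev b x.
Proof. by move=> [c /stateD ->]; rewrite lerDl state_ge0. Qed.

Lemma state_ext x y : (forall a, ev a x = ev a y) -> x = y.
Proof.
move=> h; apply: val_inj; apply: funext => a; exact: h.
Qed.

Definition mk_state (f : E -> R) (hf : is_state f) : state R E :=
  SigSub (mem_set hf : f \in @states R E).

Lemma mk_stateE f hf a : ev a (@mk_state f hf) = f a.
Proof. by []. Qed.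

(** When E is the unit interval of a lattice-ordered group, these are the
    states that extend to lattice homomorphisms. *)
Definition disjunctive_states : set (state R E) :=
  [set x | forall a b, pea_is_meet a b pea0 -> ev a x = 0 \/ ev b x = 0].

Section Component.
Hypothesis hE : RDP2 E.
Variables (x : state R E) (d : E).

(** The part of the state x that is carried by the ideal generated by d. *)
Definition component a : R :=
  sup [set ev c x | c in [set c | pea_ideal d c /\ pea_le c a]].

Let comp_sup a :
  has_sup [set ev c x | c in [set c | pea_ideal d c /\ pea_le c a]].
Proof.
split.
  exists (ev pea0 x), pea0 => //; split; last exact: pea_le0.
  exact/pea_ideal_le/pea_le0.
by exists 1 => _ [c _ <-]; exact: state_le1.
Qed.

Lemma component_ub a c : pea_ideal d c -> pea_le c a -> ev c x <= component a.
Proof.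
by move=> dc ca; apply: sup_upper_bound; [exact: comp_sup | exists c].
Qed.

Lemma component_lub a u :
  (forall c, pea_ideal d c -> pea_le c a -> ev c x <= u) -> component a <= u.
Proof.
move=> h; apply: ge_sup; first by case: (comp_sup a).
by move=> _ [c [dc ca] <-]; exact: h.
Qed.

(** A member of the ideal below a + b splits along a and b by Riesz
    decomposition. Conversely, members e1 <= a and e2 <= b must be made
    adjacent in order to be added, so e1 is taken as the right part of a and e2
    as the left part of b. *)
Lemma componentD a b c : peadd a b = Some c ->
  component c = component a + component b.
Proof.
move=> abc; apply/eqP; rewrite eq_le; apply/andP; split.
  apply: component_lub => e de ec.
  have [e1 [e2 [h12 h1 h2]]] := RDP2_le_add hE ec abc.
  rewrite (stateD _ h12); apply: lerD; apply: component_ub => //.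
    exact: (pea_ideal_down hE de (pea_le_addl h12)).
  exact: (pea_ideal_down hE de (pea_le_addr h12)).
rewrite -lerBrDr; apply: component_lub => e1 de1 /pea_leE[r re1].
rewrite lerBrDr -lerBrDl; apply: component_lub => e2 de2 [r' re2].
rewrite lerBrDl.
have [e12 [u [h1 h2 h3]]] := peadd_cross re1 re2 abc.
rewrite -(stateD _ h1); apply: component_ub; first exact: pea_idealD h1.
exact: pea_le_trans (pea_le_addr h2) (pea_le_addl h3).
Qed.

Lemma component_ge0 a : 0 <= component a.
Proof.
rewrite -(state0 x); apply: component_ub; last exact: pea_le0.
exact/pea_ideal_le/pea_le0.
Qed.

Lemma component_le a : component a <= ev a x.
Proof. by apply: component_lub => c _; exact: state_le. Qed.

Lemma component_id : component d = ev d x.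
Proof.
apply/eqP; rewrite eq_le component_le; apply: component_ub.
  exact/pea_ideal_le/pea_le_refl.
exact: pea_le_refl.
Qed.

(** Each of the summands below d of an element under e is below both d and e. *)
Lemma component_disjoint e : pea_is_meet d e pea0 -> component e = 0.
Proof.
move=> [_ _ de]; apply/eqP; rewrite eq_le component_ge0 andbT.
apply: component_lub => c.
elim=> {c} [a ad|a b c _ iha _ ihb abc] ce.
  by have := state_le x (de _ ad ce); rewrite state0.
rewrite (stateD _ abc) -[0]addr0; apply: lerD; [apply: iha|apply: ihb].
  exact: pea_le_trans (pea_le_addl abc) ce.
exact: pea_le_trans (pea_le_addr abc) ce.
Qed.

(** The component m and the rest x - m are both additive and nonnegative; once
    normalized, they exhibit x as a convex combination of two states, which
    must coincide with x. When m(1) = 1 there is no rest, and m = x directly. *)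
Lemma component_extremal : extremal_states x -> 0 < ev d x ->
  forall a, component a = component pea1 * ev a x.
Proof.
move=> ex dgt0.
set t := component pea1.
have mono a : component a <= t.
  have [e [ae _]] := pea_complr a.
  by rewrite /t (componentD ae) lerDl component_ge0.
have t0 : 0 < t by rewrite (lt_le_trans dgt0)// -component_id.
have := component_le pea1; rewrite state1 -/t le_eqVlt => /predU1P[t1|tlt1] a.
  rewrite t1 mul1r.
  have [e [ae _]] := pea_complr a.
  have := componentD ae; rewrite -/t t1 -(state1 x) (stateD _ ae).
  have := component_le a; have := component_le e; lra.
have st1 : is_state (fun a => component a / t).
  split=> [b|b1 b2 b /componentD ->|]; last by rewrite divff// gt_eqF.
    rewrite ler_pdivrMr// mul1r mono andbT.
    by apply: divr_ge0; [exact: component_ge0 | exact: ltW].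
  by rewrite mulrDl.
have t1' : 0 < 1 - t by rewrite subr_gt0.
have resD b1 b2 b : peadd b1 b2 = Some b ->
    ev b x - component b = ev b1 x - component b1 + (ev b2 x - component b2).
  by move=> h; rewrite (componentD h) (stateD _ h); ring.
have st2 : is_state (fun a => (ev a x - component a) / (1 - t)).
  split=> [b|b1 b2 b /resD ->|].
  - apply/andP; split.
      by apply: divr_ge0; [rewrite subr_ge0 component_le | exact: ltW].
    rewrite ler_pdivrMr// mul1r.
    have [e [be _]] := pea_complr b.
    have := resD _ _ _ be; rewrite -/t state1 => ->.
    by rewrite lerDl subr_ge0 component_le.
  - by rewrite mulrDl.
  - by rewrite state1 -/t divff// gt_eqF.
have [|b|+ _] := ex (mk_state st1) (mk_state st2) t.
- by rewrite t0.
- rewrite !mk_stateE !(mulrC _ (_ / _)) !mulfVK ?gt_eqF//; ring.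
by move=> <-; rewrite mk_stateE mulrC mulfVK// gt_eqF.
Qed.

End Component.

Lemma extremal_disjunctive (hE : RDP2 E) :
  @extremal_states R E `<=` disjunctive_states.
Proof.
move=> x ex d e de.
have := state_ge0 x d; rewrite le_eqVlt => /predU1P[<-|d0]; [by left|right].
have /(_ e) := component_extremal hE ex d0.
rewrite component_disjoint// => /esym/eqP; rewrite mulf_eq0 => /orP[|/eqP//].
rewrite gt_eqF// (lt_le_trans d0)// -(component_id x d).
apply: component_lub => c dc cd; apply: component_ub => //.
by apply: pea_le_trans cd _; have [r [? _]] := pea_complr d; exists r.
Qed.

End Facts.

(** * Operations on the functions induced by the elements of E *)
Section Clamp.
Variable R : realType.

Definition clamp (t : R) : R := Num.min 1 (Num.max 0 t).

Lemma clamp_le0 t : t <= 0 -> clamp t = 0.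
Proof. by move=> t0; rewrite /clamp max_l// min_r. Qed.

Lemma clamp_ge1 t : 1 <= t -> clamp t = 1.
Proof. by move=> t1; rewrite /clamp max_r ?min_l// (le_trans _ t1). Qed.

Lemma clamp_id t : 0 <= t <= 1 -> clamp t = t.
Proof. by move=> /andP[t0 t1]; rewrite /clamp max_r// min_r. Qed.

(** The carry rule behind [ev_clamp]: to add f to a number t already sliced
    into unit layers, the layer clamp t receives what overflows from the layer
    just below, clamp (t + 1). *)
Lemma clamp_addE (t f : R) : 0 <= f <= 1 ->
  clamp (t + f) = clamp (clamp t + clamp (clamp (t + 1) + f - 1)).
Proof.
move=> /andP[f0 f1].
have [t1|t1] := lerP t (-1).
  rewrite (@clamp_le0 t) ?(@clamp_le0 (t + 1)) ?(@clamp_le0 (t + f)); [|lra..].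
  by rewrite !clamp_le0//; lra.
have [t0|t0] := lerP t 0.
  rewrite (@clamp_le0 t)// (@clamp_id (t + 1)); last by apply/andP; lra.
  rewrite add0r [RHS]clamp_id.
    by congr clamp; lra.
  by rewrite /clamp le_min ge_min lexx ler01 le_max lexx.
rewrite (@clamp_ge1 (t + 1)); last lra.
rewrite (@clamp_id (1 + f - 1)); last by apply/andP; lra.
have [t2|t2] := lerP 1 t; first by rewrite !(@clamp_ge1 t)// !clamp_ge1//; lra.
rewrite (@clamp_id t); last by apply/andP; lra.
by congr clamp; lra.
Qed.

Lemma sum_clamp (t : R) n : 0 <= t <= n%:R ->
  \sum_(k < n) clamp (t - k%:R) = t.
Proof.
elim: n => [|n ih] /andP[t0 tn]; first by rewrite big_ord0; lra.
rewrite big_ord_recr/=.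
have [tln|ntl] := lerP t n%:R.
  by rewrite ih ?t0// clamp_le0 ?addr0//; lra.
rewrite (@clamp_id (t - n%:R)); last first.
  by apply/andP; move: tn; rewrite -natr1; lra.
rewrite (eq_bigr (fun=> 1)); first by rewrite sumr_const card_ord; lra.
move=> k _; apply: clamp_ge1.
have : k.+1%:R <= n%:R :> R by rewrite ler_nat.
rewrite -natr1; lra.
Qed.

End Clamp.

Section HatOperations.
Variables (R : realType) (E : pseudoEffectAlgebraType).
Implicit Types (a b c d : E) (x y z : state R E).
Local Notation ev := (@state_eval R E).
Local Notation Y := (@disjunctive_states R E).

Lemma ev_compl a : exists c, forall x, ev c x = 1 - ev a x.
Proof.
have [c [ac _]] := pea_complr a; exists c => x.
by rewrite -(state1 x) (stateD x ac); ring.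
Qed.

Hypothesis hE : RDP2 E.

(** Decompose 1 = a + a' = b' + b. At a disjunctive state d2 or d3 vanishes, so
    that d1 takes the value min (x(a), 1 - x(b)); the element d1 + b,
    which takes the value min (1, x(a) + x(b)), exists because d1 is a right
    part of b'. *)
Lemma ev_oplus a b :
  exists c, forall x, Y x -> ev c x = Num.min 1 (ev a x + ev b x).
Proof.
have [a' [aa' _]] := pea_complr a; have [b' [b'b _]] := pea_compll b.
have [d1 [d2 [d3 [d4 [h12 h34 h13 h24 d23]]]]] := hE aa' b'b.
have [d3' [_ [h31 _]]] := peadd_swap _ _ _ h13.
have [c hc _] := peaddA_r h31 b'b.
exists c => x Yx; rewrite (stateD x hc).
have := stateD x b'b; rewrite state1 (stateD x h13).
rewrite (stateD x h12).
have := state_ge0 x d2; have := state_ge0 x d3.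
by case: (Yx _ _ d23) => -> *; case: ltrP; lra.
Qed.

Lemma ev_odot a b :
  exists c, forall x, Y x -> ev c x = Num.max 0 (ev a x + ev b x - 1).
Proof.
have [a' ha'] := ev_compl a; have [b' hb'] := ev_compl b.
have [c hc] := ev_oplus a' b'; have [c' hc'] := ev_compl c.
exists c' => x Yx; rewrite hc' hc// ha' hb'.
by case: ltrP => ?; case: ltrP => ?; lra.
Qed.

Lemma ev_min a b :
  exists c, forall x, Y x -> ev c x = Num.min (ev a x) (ev b x).
Proof.
have [b' hb'] := ev_compl b.
have [c hc] := ev_odot a b'; have [c' hc'] := ev_compl c.
have [e he] := ev_odot a c'.
(* min (u, v) = u - max (0, u - v) *)
exists e => x Yx; rewrite he// hc' hc// hb'.
have a0 := state_ge0 x a; have b0 := state_ge0 x b.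
have [ab|ba] := lerP (ev a x) (ev b x).
  by rewrite (@max_l _ _ 0 (ev a x + (1 - ev b x) - 1)) ?max_r; lra.
by rewrite (@max_r _ _ 0 (ev a x + (1 - ev b x) - 1)) ?max_r; lra.
Qed.

Lemma ev_clamp a n k : exists c,
  forall x, Y x -> ev c x = clamp (n%:R * ev a x - k%:R).
Proof.
elim: n k => [|n ih] k.
  exists pea0 => x _; rewrite state0 mul0r clamp_le0// sub0r oppr_le0 ler0n//.
have evE x j : n.+1%:R * ev a x - j%:R = n%:R * ev a x - j%:R + ev a x.
  by rewrite -natr1; ring.
have clamp_bd (t : R) : 0 <= clamp t.
  by rewrite /clamp le_min ler01 le_max lexx.
case: k => [|k].
  have [c hc] := ih 0; have [e he] := ev_oplus c a; exists e => x Yx.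
  have a0 := state_ge0 x a.
  rewrite he// hc// evE subr0.
  have nt0 : 0 <= n%:R * ev a x by rewrite mulr_ge0.
  rewrite /clamp (max_r nt0) max_r ?addr_ge0//.
  have [nt1|nt1] := lerP 1 (n%:R * ev a x); last by [].
  by rewrite !min_l//; lra.
have [c hc] := ih k.+1; have [e he] := ih k.
have [f hf] := ev_odot e a; have [g hg] := ev_oplus c f.
exists g => x Yx.
rewrite hg// hc// hf// he// evE.
rewrite (@clamp_addE _ (n%:R * ev a x - k.+1%:R)) ?state_ge0 ?state_le1//.
have -> : n%:R * ev a x - k.+1%:R + 1 = n%:R * ev a x - k%:R.
  by rewrite -natr1; ring.
set u := clamp (_ - k.+1%:R); set v := clamp (_ - k%:R).
have a1 := state_le1 x a.
have v1 : v <= 1 by rewrite /v /clamp ge_min lexx.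
have -> : clamp (v + ev a x - 1) = Num.max 0 (v + ev a x - 1).
  by rewrite /clamp min_r// ge_max ler01/=; lra.
by rewrite /clamp (@max_r _ _ 0 (u + _))// addr_ge0 ?clamp_bd// le_max lexx.
Qed.

(** Stretch the function of a until the gap from p to q has length at least 2;
    it then contains a full interval [k, k + 1] to truncate to. *)
Lemma ev_separate a (p q : R) : 0 <= p -> p < q -> exists c, forall z, Y z ->
  (ev a z <= p -> ev c z = 0) /\ (q <= ev a z -> ev c z = 1).
Proof.
move=> p0 pq.
pose n := (Num.truncn (2 / (q - p))).+1.
have qp : 0 < q - p by rewrite subr_gt0.
have hn : 2 <= n%:R * (q - p).
  by rewrite -ler_pdivrMr// ltW// /n truncnS_gt.
pose k := (Num.truncn (n%:R * p)).+1.
have np0 : 0 <= n%:R * p by rewrite mulr_ge0.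
have npk : n%:R * p < k%:R by rewrite /k truncnS_gt.
have knp : k%:R <= n%:R * p + 1.
  by rewrite /k -natr1 lerD2r truncn_le.
have [c hc] := ev_clamp a n k; exists c => z Yz; rewrite hc//; split=> h.
  apply: clamp_le0; have : n%:R * ev a z <= n%:R * p by rewrite ler_wpM2l.
  lra.
apply: clamp_ge1; have : n%:R * q <= n%:R * ev a z by rewrite ler_wpM2l.
lra.
Qed.

(** A state y with x = t y + (1 - t) z vanishes where x does, so it is itself
    disjunctive. If x(a) < y(a), an element separating these two values
    vanishes at x but not at y; the other inequality follows by taking
    complements. *)
Lemma disjunctive_extremal : Y `<=` @extremal_states R E.
Proof.
have key x y z t : Y x -> 0 < t < 1 ->
    (forall a, ev a x = t * ev a y + (1 - t) * ev a z) -> y = x.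
  move=> Yx /andP[t0 t1] xyz.
  have ker a : ev a x = 0 -> ev a y = 0.
    rewrite xyz => h; have := state_ge0 y a; have := state_ge0 z a => z0 y0.
    have : 0 <= (1 - t) * ev a z by rewrite mulr_ge0// subr_ge0 ltW.
    have : 0 <= t * ev a y by rewrite mulr_ge0// ltW.
    move=> u v; have : t * ev a y = 0 by lra.
    by move/eqP; rewrite mulf_eq0 gt_eqF//= => /eqP.
  have Yy : Y y by move=> a b /Yx[]/ker; [left|right].
  have yx a : ev a y <= ev a x.
    rewrite leNgt; apply/negP => xy.
    have [c hc] := ev_separate a (state_ge0 x a) xy.
    have /ker : ev c x = 0 by have [->] := hc _ Yx.
    by have [_ ->//] := hc _ Yy; move/eqP; rewrite oner_eq0.
  apply: state_ext => a; apply/eqP; rewrite eq_le yx/=.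
  by have [c hc] := ev_compl a; have := yx c; rewrite !hc; lra.
move=> x Yx y z t t01 xyz; split; first exact: key xyz.
apply: (key x z y (1 - t)) => //.
  by move: t01 => /andP[? ?]; apply/andP; lra.
by move=> a; rewrite xyz; ring.
Qed.

Lemma extremal_statesE : @extremal_states R E = Y.
Proof.
apply/seteqP; split; first exact: extremal_disjunctive.
exact: disjunctive_extremal.
Qed.

End HatOperations.

(** * Compactness of the state space *)
Section Compactness.

(** Compactness as an induction principle: otherwise the sets S for which Q
    holds of A minus S form a proper filter containing A, without any cluster
    point in A. *)
Lemma compact_set_induction (T : topologicalType) (A : set T)
    (Q : set T -> Prop) :
  compact A -> Q set0 -> (forall U V, Q U -> Q V -> Q (U `|` V)) ->
  (forall U V, U `<=` V -> Q V -> Q U) ->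
  (forall x, A x -> exists2 V, nbhs x V & Q V) -> Q A.
Proof.
move=> cA Q0 QU Qsub Qloc; apply: contrapT => nQA.
pose F : set (set T) := [set S | Q (A `\` S)].
have FF : ProperFilter F.
  split; first by rewrite /F /= setD0.
  split=> [|S U QS QV|S U SU].
  - by rewrite /F /= setDT.
  - change (Q (A `\` (S `&` U))).
    by rewrite setDE setCI setIUr -!setDE; exact: QU.
  - by apply: Qsub; exact: setDS.
have [|p [Ap clp]] := cA F FF; first by rewrite /F /= setDv.
have [V pV QV] := Qloc p Ap.
have [|q [nVq Vq]] := clp (~` V) V _ pV; last exact: nVq.
by rewrite /F /= setDE setCK; apply: Qsub QV; exact: subIsetr.
Qed.

Lemma continuous_sub_add (R : realType) (T : topologicalType)
    (u v w : T -> R) :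
  continuous u -> continuous v -> continuous w ->
  continuous (fun t => u t - (v t + w t)).
Proof.
move=> cu cv cw t; apply: cvgB; first exact: cu.
by apply: cvgD; [exact: cv | exact: cw].
Qed.

Variables (R : realType) (E : pseudoEffectAlgebraType).
Implicit Types (a b c d : E) (x y z : state R E).
Local Notation ev := (@state_eval R E).
Local Notation K := (state R E).
Local Notation Y := (@disjunctive_states R E).

Lemma ev_continuous a : continuous (ev a : K -> R).
Proof.
move=> x; apply: (@continuous_comp _ _ _ (set_val : K -> {ptws E -> R})
  (fun f : {ptws E -> R} => f a)).
  exact: initial_continuous.
exact: (@proj_continuous {classic E} (fun=> R) a).
Qed.

Lemma compact_states : compact (@states R E).
Proof.
have /(subclosed_compact _) :
    compact [set f : {ptws E -> R} | forall a, `[0, 1]%classic (f a)].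
  exact: (@tychonoff {classic E} (fun=> R) (fun=> `[0, 1]%classic)
     (fun=> @segment_compact R 0 1)).
apply; last by move=> f [f01 _ _] a /=; rewrite in_itv /=; exact: f01.
have projc a : continuous (fun f : {ptws E -> R} => f a).
  exact: (@proj_continuous {classic E} (fun=> R) a).
have -> : @states R E =
   (\bigcap_a [set f : {ptws E -> R} | `[0, 1]%classic (f a)]) `&`
   ((\bigcap_(abc in [set abc : E * E * E | peadd abc.1.1 abc.1.2 = Some abc.2])
     [set f : {ptws E -> R} | f abc.2 - (f abc.1.1 + f abc.1.2) = 0]) `&`
   [set f : {ptws E -> R} | f pea1 = 1]).
  apply/seteqP; split=> f /=.
    move=> [f01 fD f1]; split; first by move=> a _ /=; rewrite in_itv/= f01.
    split=> // -[[a b] c] /= abc; rewrite (fD _ _ _ abc); ring.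
  move=> [f01 [fD f1]]; split=> //.
  - by move=> a; have := f01 a I; rewrite /= in_itv.
  - move=> a b c abc; have := fD (a, b, c) abc; rewrite /=; lra.
apply: closedI; last apply: closedI.
- apply: closed_bigI => a _.
  apply: (preimage_closed (f := fun f : {ptws E -> R} => f a)) => [f _|].
    exact: projc.
  exact: interval_closed.
- apply: closed_bigI => -[[a b] c] _ /=.
  apply: (preimage_closed (f := fun f : {ptws E -> R} => f c - (f a + f b))
    (D := [set t | t = 0])) => [f _|].
    exact: (continuous_sub_add (projc c) (projc a) (projc b)).
  exact: closed_eq.
- apply: (preimage_closed (f := fun f : {ptws E -> R} => f pea1)
    (D := [set t | t = 1])) => [f _|].
    exact: projc.
  exact: closed_eq.
Qed.

Lemma compact_state_space : compact [set: K].
Proof.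
move=> F FF _.
have [|f [sf clf]] := compact_states (F := (set_val : K -> {ptws E -> R}) @ F).
  by apply: (@filterS _ F _ setT) => [x _|]; [exact: set_valP|exact: filterT].
exists (SigSub (mem_set sf)); split=> // A B FA.
rewrite nbhsE => -[U [[V oV <-] Vf] VB].
have [||_ [[x Ax <-] Vx]] := clf (set_val @` A) V.
- by apply: (@filterS _ F _ A) => [x Ax|//]; exists x.
- by apply: open_nbhs_nbhs; split.
by exists x; split=> //; apply: VB.
Qed.

Lemma closed_disjunctive : closed Y.
Proof.
have -> : Y = \bigcap_(ab in [set ab : E * E | pea_is_meet ab.1 ab.2 pea0])
   ([set x | ev ab.1 x = 0] `|` [set x | ev ab.2 x = 0]).
  apply/seteqP; split=> [x Yx [a b] /= /Yx//|x Yx a b ab].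
  exact: Yx (a, b) ab.
have cl0 a : closed [set x : K | ev a x = 0].
  apply: (preimage_closed (f := ev a) (D := [set t | t = 0])) => [f _|].
    exact: ev_continuous.
  exact: closed_eq.
by apply: closed_bigI => ab _; exact: closedU.
Qed.

End Compactness.

(** * Bauer's minimum principle *)
Section Bauer.
Variables (R : realType) (E : pseudoEffectAlgebraType).
Implicit Types (a b c d : E) (x y z : state R E).
Local Notation ev := (@state_eval R E).
Local Notation K := (state R E).
Local Notation X := (@extremal_states R E).

Definition convex_comb (t : R) y z x :=
  0 < t < 1 /\ forall a, ev a x = t * ev a y + (1 - t) * ev a z.

Definition affine_continuous (h : K -> R) := continuous h /\
  forall t y z x, convex_comb t y z x -> h x = t * h y + (1 - t) * h z.

Lemma affine_cst (r : R) : affine_continuous (fun=> r).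
Proof.
by split=> [|t y z x _]; [exact: cst_continuous | rewrite /=; ring].
Qed.

Lemma affine_ev a : affine_continuous (ev a).
Proof. by split=> [|t y z x []//]; exact: ev_continuous. Qed.

Lemma affineD f g : affine_continuous f -> affine_continuous g ->
  affine_continuous (fun x => f x + g x).
Proof.
move=> [cf af] [cg ag]; split=> [x|t y z x xyz].
  by apply: (@cvgD _ _ _ (nbhs x)); [exact: cf | exact: cg].
by rewrite (af _ _ _ _ xyz) (ag _ _ _ _ xyz); ring.
Qed.

Lemma affineN f : affine_continuous f -> affine_continuous (fun x => - f x).
Proof.
move=> [cf af]; split=> [x|t y z x xyz].
  by apply: (@cvgN _ _ _ (nbhs x)); exact: cf.
by rewrite (af _ _ _ _ xyz); ring.
Qed.

Lemma affineZ (r : R) f : affine_continuous f ->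
  affine_continuous (fun x => r * f x).
Proof.
move=> [cf af]; split=> [x|t y z x xyz].
  by apply: (@cvgM _ _ (nbhs x)); [exact: cvg_cst | exact: cf].
by rewrite (af _ _ _ _ xyz); ring.
Qed.

Lemma affine_sum n (f : 'I_n -> K -> R) :
  (forall i, affine_continuous (f i)) ->
  affine_continuous (fun x => \sum_(i < n) f i x).
Proof.
elim: n f => [|n ih] f af.
  by under eq_fun do rewrite big_ord0; exact: affine_cst.
by under eq_fun do rewrite big_ord_recr/=; apply: affineD => //; exact: ih.
Qed.

Definition face (F : set K) :=
  forall t y z x, convex_comb t y z x -> F x -> F y /\ F z.

Definition argmin (F : set K) (h : K -> R) :=
  [set x | F x /\ forall y, F y -> h x <= h y].

Lemma argmin_face F h : affine_continuous h -> face F -> face (argmin F h).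
Proof.
move=> [_ ah] fF t y z x xyz [Fx hx].
have [Fy Fz] := fF _ _ _ _ xyz Fx.
have := ah _ _ _ _ xyz; case: xyz => /andP[t0 t1] _ xE.
have t1' : 0 < 1 - t by rewrite subr_gt0.
have := hx _ Fy; have := hx _ Fz.
move=> hxz hxy.
have hxt : t * h x <= t * h y by rewrite ler_pM2l.
have hxt' : (1 - t) * h x <= (1 - t) * h z by rewrite ler_pM2l.
split; split=> // w Fw; apply: le_trans (hx _ Fw).
  by rewrite -(ler_pM2l t0); lra.
by rewrite -(ler_pM2l t1'); lra.
Qed.

Lemma argmin_nonempty_closed F h : affine_continuous h -> closed F ->
  F !=set0 -> argmin F h !=set0 /\ closed (argmin F h).
Proof.
move=> [ch _] cF F0.
have cpF : compact F.
  exact: (subclosed_compact cF (@compact_state_space R E)).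
have [|c cF' hc] := compact_EVT_min F0 cpF (f := h).
  exact: continuous_subspaceT.
have {}hc y : F y -> h c <= h y by move=> Fy; apply: hc; rewrite inE.
move: cF'; rewrite inE => Fc.
split; first by exists c.
have -> : argmin F h = F `&` [set x | h x <= h c].
  apply/seteqP; split=> x [Fx hx]; split=> //; first exact: hx.
  by move=> y Fy; exact: le_trans (hc _ Fy).
apply: closedI => //.
apply: (preimage_closed (f := h) (D := [set t | t <= h c])) => [x _|].
  exact: ch.
exact: closed_le.
Qed.

(** Zorn's lemma, applied to complements of closed faces meeting the closed
    face F0 where h is minimal, yields a minimal such face; chains are handled
    by compactness. Every evaluation is minimal on a closed subface, hence
    constant on this minimal face. Evaluations separate states, so the face is
    a single point, which is extremal and minimizes h. *)
Lemma bauer_minimum h : affine_continuous h ->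
  forall x, exists2 p, X p & h p <= h x.
Proof.
move=> ah x0.
pose F0 := argmin [set: K] h.
have [F0n F0c] : F0 !=set0 /\ closed F0.
  by apply: argmin_nonempty_closed => //; exists x0.
have F0f : face F0 by exact: argmin_face.
pose P := [set U : set K | [/\ open U, face (~` U) & (~` U) `&` F0 !=set0]].
have [] := @Zorn_bigcup K P.
  move=> C CP Ctot; split.
  - by apply: bigcup_open => U /CP[].
  - move=> t y z x xyz nCx.
    have fU U : C U -> ~ U y /\ ~ U z.
      move=> CU; have [_ fU _] := CP _ CU; apply: fU xyz _ => Ux.
      by apply: nCx; exists U.
    by split=> -[U CU]; have [] := fU _ CU.
  - apply: contrapT => nF0.
    (* If the union of the chain C covered F0, a single member would. The empty
       set stands in for a member while C may still be empty. *)
    have [W [CW F0W]] : exists W, (W = set0 \/ C W) /\ F0 `&` F0 `<=` W.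
      apply: (@compact_set_induction K F0 (fun V =>
          exists W, (W = set0 \/ C W) /\ V `&` F0 `<=` W)).
      + exact: (subclosed_compact F0c (@compact_state_space R E)).
      + by exists set0; split; [left | rewrite set0I].
      + move=> U V [W [CW UW]] [W' [CW' VW']].
        have [WW'|WW'] : W `<=` W' \/ W' `<=` W.
          case: CW => [->|CW]; first by left.
          case: CW' => [->|CW']; first by right.
          exact: Ctot.
          exists W'; split=> // x [[Ux|Vx] Fx]; last exact: VW'.
          by apply/WW'/UW.
        exists W; split=> // x [[Ux|Vx] Fx]; first exact: UW.
        by apply/WW'/VW'.
      + move=> U V UV [W [CW VW]]; exists W; split=> // x [/UV Ux Fx].
        exact: VW.
      + move=> x F0x; have [U CU Ux] : (\bigcup_(U in C) U) x.
          by apply: contrapT => nCx; apply: nF0; exists x.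
        have [oU _ _] := CP _ CU.
        exists U; first by apply: open_nbhs_nbhs; split.
        by exists U; split; [right | move=> ? []].
    case: CW => [W0|/CP[_ _ [x [nWx F0x]]]].
      by have [x F0x] := F0n; move: (F0W x (conj F0x F0x)); rewrite W0.
    by apply: nWx; exact: F0W.
move=> A [[oA fA [p [nAp F0p]]] maxA].
have min_const a : ~` A `<=` argmin (~` A `&` F0) (ev a).
  have fAF : face (~` A `&` F0).
    by move=> t y z x xyz [/(fA _ _ _ _ xyz)[? ?] /(F0f _ _ _ _ xyz)[? ?]].
  have [|G0 Gc] := @argmin_nonempty_closed (~` A `&` F0) _ (affine_ev a) _
    (ex_intro _ p (conj nAp F0p)).
    by apply: closedI => //; exact: open_closedC.
  apply: contrapT => nAG.
  apply: (maxA (~` (argmin (~` A `&` F0) (ev a)))).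
    split; first by move=> x Ax [[]].
    move=> sub; apply: nAG => x nAx; apply: contrapT => nGx.
    exact/nAx/sub.
  split.
  - exact: closed_openC.
  - by rewrite setCK; apply: argmin_face => //; exact: affine_ev.
  - by rewrite setCK; have [q Gq] := G0; exists q; split=> //; case: Gq => -[].
have uniqA y : (~` A) y -> y = p.
  move=> nAy; apply: state_ext => a; apply/eqP; rewrite eq_le.
  have [yF ymin] := min_const a y nAy; have [pF pmin] := min_const a p nAp.
  by rewrite ymin// pmin.
exists p; last by case: F0p => _; apply.
move=> y z t t01 xyz.
by have [] := fA t y z p (conj t01 xyz) nAp; split; exact: uniqA.
Qed.

Lemma le_on_extremal f g : affine_continuous f -> affine_continuous g ->
  (forall x, X x -> f x <= g x) -> forall x, f x <= g x.
Proof.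
move=> af ag fg x.
have [p Xp] := bauer_minimum (affineD ag (affineN af)) x.
have := fg _ Xp; lra.
Qed.

End Bauer.

(** * Urysohn functions from elements of E *)
Section Urysohn.
Variables (R : realType) (E : pseudoEffectAlgebraType).
Hypothesis hE : RDP2 E.
Implicit Types (a b c d : E) (x y z : state R E).
Local Notation ev := (@state_eval R E).
Local Notation K := (state R E).
Local Notation X := (@extremal_states R E).

Lemma closed_extremal : closed X.
Proof. by rewrite extremal_statesE//; exact: closed_disjunctive. Qed.

Lemma closed_extremal_ge a e : closed (X `&` [set x | e <= ev a x]).
Proof.
apply: closedI; first exact: closed_extremal.
apply: (preimage_closed (f := ev a) (D := [set t | e <= t])) => [x _|].
  exact: ev_continuous.
exact: closed_ge.
Qed.

Lemma ev_separate_points x y : X x -> X y -> x <> y ->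
  exists c V W, [/\ nbhs x V, nbhs y W, forall z, X z -> V z -> ev c z = 0 &
                    forall z, X z -> W z -> ev c z = 1].
Proof.
rewrite extremal_statesE// => Xx Xy xy.
have [a axy] : exists a, ev a x < ev a y.
  apply: contrapT => nlt; apply: xy; apply: state_ext => a.
  apply/eqP; rewrite eq_le; apply/andP; split; rewrite leNgt; apply/negP => lt.
    have [c hc] := ev_compl R a; apply: nlt; exists c; rewrite !hc; lra.
  by apply: nlt; exists a.
pose p := (2 * ev a x + ev a y) / 3; pose q := (ev a x + 2 * ev a y) / 3.
have x0 := state_ge0 x a.
have [||c hc] := @ev_separate R E hE a p q.
- by rewrite /p; lra.
- by rewrite /p /q; lra.
exists c, (ev a @^-1` [set t | t < p]), (ev a @^-1` [set t | q < t]).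
have nb z (D : set R) : open D -> D (ev a z) -> nbhs z (ev a @^-1` D).
  by move=> oD Dz; apply: ev_continuous; apply: open_nbhs_nbhs; split.
split.
- by apply: nb; [exact: open_lt|rewrite /= /p; lra].
- by apply: nb; [exact: open_gt|rewrite /= /q; lra].
- by move=> z Xz /= /ltW zp; case: (hc z Xz) => ->.
- by move=> z Xz /= /ltW zp; case: (hc z Xz) => _ ->.
Qed.

(** A minimum of finitely many of the functions separating y from a point
    outside O, by compactness of X minus O. *)
Lemma ev_urysohn y (O : set K) : X y -> open O -> O y ->
  exists c W, [/\ nbhs y W, forall z, X z -> W z -> ev c z = 1 &
                  forall z, X z -> ~ O z -> ev c z = 0].
Proof.
move=> Xy oO Oy.
suff [c [W [yW W1 c0]]] : exists c W, [/\ nbhs y W,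
    forall z, X z -> W z -> ev c z = 1 &
    forall z, X z -> (X `\` O) z -> ev c z = 0].
  by exists c, W; split=> // z Xz Oz; apply: c0.
apply: (@compact_set_induction K (X `\` O) (fun V => exists c W, [/\ nbhs y W,
    forall z, X z -> W z -> ev c z = 1 & forall z, X z -> V z -> ev c z = 0])).
- apply: (subclosed_compact _ (@compact_state_space R E)) => //.
  by apply: closedI; [exact: closed_extremal|exact: open_closedC].
- exists pea1, setT; split=> //; first exact: filterT.
  by move=> z _ _; exact: state1.
- move=> U V [c [W [yW W1 c0]]] [c' [W' [yW' W1' c0']]].
  have [e he] := ev_min R hE c c'.
  exists e, (W `&` W'); split; first exact: filterI.
    move=> z Xz [Wz W'z]; rewrite he -?extremal_statesE//.
    by rewrite W1// W1'// minxx.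
  move=> z Xz UVz; rewrite he -?extremal_statesE//.
  case: UVz => [Uz|Vz]; first by rewrite c0// min_l// state_ge0.
  by rewrite c0'// min_r// state_ge0.
- move=> U V UV [c [W [yW W1 c0]]]; exists c, W; split=> // z Xz /UV.
  exact: c0.
- move=> x [Xx nOx].
  have [|c [V [W [xV yW c0 c1]]]] := ev_separate_points Xx Xy.
    by move=> xy; apply: nOx; rewrite xy.
  by exists V => //; exists c, W; split.
Qed.

(** A substitute for partitions of unity: the Urysohn functions of finitely
    many points of C are grouped, by truncated sums, according to the set O i
    in which they live. *)
Lemma ev_cover (C : set K) (O : nat -> set K) : closed C -> C `<=` X ->
  (forall i, open (O i)) -> C `<=` \bigcup_i O i ->
  exists N (b : nat -> E), (forall i z, X z -> ~ O i z -> ev (b i) z = 0) /\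
    forall z, C z -> 1 <= \sum_(i < N) ev (b i) z.
Proof.
move=> cC CX oO CO.
suff [N [b [b0 b1]]] : exists N (b : nat -> E),
    (forall i z, X z -> ~ O i z -> ev (b i) z = 0) /\
    forall z, X z -> C z -> 1 <= \sum_(i < N) ev (b i) z.
  by exists N, b; split=> // z Cz; apply: b1 => //; exact: CX.
apply: (@compact_set_induction K C (fun V => exists N (b : nat -> E),
    (forall i z, X z -> ~ O i z -> ev (b i) z = 0) /\
    forall z, X z -> V z -> 1 <= \sum_(i < N) ev (b i) z)).
- exact: (subclosed_compact cC (@compact_state_space R E)).
- by exists 0%N, (fun=> pea0); split=> // i z _ _; exact: state0.
- move=> U V [N [b [b0 b1]]] [N' [b' [b0' b1']]].
  have /choice[e he] : forall i, exists c, forall x, X x ->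
      ev c x = Num.min 1 (ev (b i) x + ev (b' i) x).
    by rewrite extremal_statesE// => i; exact: ev_oplus.
  exists (maxn N N'), e; split=> [i z Xz nOz|z Xz UVz].
    by rewrite he// b0// b0'// addr0 min_r.
  have mono n (f : nat -> E) : (n <= maxn N N')%N ->
      (forall i, ev (f i) z <= ev (e i) z) ->
      \sum_(i < n) ev (f i) z <= \sum_(i < maxn N N') ev (e i) z.
    move=> nN fe; rewrite -(big_mkord xpredT (fun i => ev (f i) z)).
    rewrite -(big_mkord xpredT (fun i => ev (e i) z)).
    rewrite (@big_cat_nat _ _ _ n 0 (maxn N N'))//= -[leLHS]addr0.
    apply: lerD.
      by apply: ler_sum.
    by apply: sumr_ge0 => i _; exact: state_ge0.
  case: UVz => [/(b1 _ Xz)|/(b1' _ Xz)] /le_trans; apply; apply: mono.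
  + exact: leq_maxl.
  + by move=> i; rewrite he// le_min state_le1 lerDl state_ge0.
  + exact: leq_maxr.
  + by move=> i; rewrite he// le_min state_le1 lerDr state_ge0.
- move=> U V UV [N [b [b0 b1]]]; exists N, b; split=> // z Xz /UV.
  exact: b1.
- move=> x Cx; have [i _ Oix] := CO _ Cx.
  have [c [W [xW W1 c0]]] := ev_urysohn (CX _ Cx) (oO i) Oix.
  exists W => //; exists i.+1, (fun j => if j == i then c else pea0); split.
    move=> j z Xz; case: eqP => [->|_ _]; [exact: c0|exact: state0].
  move=> z Xz Wz; rewrite big_ord_recr/= eqxx W1// lerDr.
  by apply: sumr_ge0 => j _; exact: state_ge0.
Qed.

End Urysohn.

(** * The outer measure of a state *)
Section RepresentingMeasure.
Variables (R : realType) (E : pseudoEffectAlgebraType).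
Hypothesis hE : RDP2 E.
Variable s : state R E.
Implicit Types (a b c d : E) (x y z : state R E).
Local Notation ev := (@state_eval R E).
Local Notation K := (state R E).
Local Notation X := (@extremal_states R E).

Definition vanishes_off (O : set K) a := forall x, X x -> ~ O x -> ev a x = 0.

Definition content (O : set K) : R := sup [set ev a s | a in vanishes_off O].

Definition outer_content (A : set K) : R :=
  inf [set content O | O in [set O | open O /\ A `<=` O]].

Let has_sup_content O : has_sup [set ev a s | a in vanishes_off O].
Proof.
split; first by exists (ev pea0 s), pea0 => // x _ _; exact: state0.
by exists 1 => _ [a _ <-]; exact: state_le1.
Qed.

Lemma content_ub O a : vanishes_off O a -> ev a s <= content O.
Proof.
by move=> aO; apply: sup_upper_bound; [exact: has_sup_content | exists a].
Qed.

Lemma content_lub O u : (forall a, vanishes_off O a -> ev a s <= u) ->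
  content O <= u.
Proof.
move=> h; apply: ge_sup; first by case: (has_sup_content O).
by move=> _ [a aO <-]; exact: h.
Qed.

Lemma content_ge0 O : 0 <= content O.
Proof. by rewrite -(state0 s); apply: content_ub => x _ _; exact: state0. Qed.

Lemma le_content O O' : O `<=` O' -> content O <= content O'.
Proof.
move=> OO'; apply: content_lub => a aO; apply: content_ub => x Xx nO'x.
by apply: aO => // /OO'.
Qed.

Lemma content_eq0 O : (forall x, X x -> ~ O x) -> content O = 0.
Proof.
move=> XO; apply/eqP; rewrite eq_le content_ge0 andbT.
apply: content_lub => a aO; apply: (@le_on_extremal _ _ (ev a) (fun=> 0)).
- exact: affine_ev.
- exact: affine_cst.
- by move=> x Xx; rewrite aO//; exact: XO.
Qed.

Let has_inf_outer (A : set K) :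
  has_inf [set content O | O in [set O | open O /\ A `<=` O]].
Proof.
split; first by exists (content setT), setT; split=> //; exact: openT.
by exists 0 => _ [U _ <-]; exact: content_ge0.
Qed.

Lemma outer_content_lb A O : open O -> A `<=` O -> outer_content A <= content O.
Proof.
by move=> oO AO; apply: ge_inf; [case: (has_inf_outer A) | exists O].
Qed.

Lemma outer_content_glb A u :
  (forall O, open O -> A `<=` O -> u <= content O) -> u <= outer_content A.
Proof.
move=> h; apply: lb_le_inf; first by case: (has_inf_outer A).
by move=> _ [U [oU AU] <-]; exact: h.
Qed.

Lemma outer_content_approx A (e : R) : 0 < e ->
  exists O, [/\ open O, A `<=` O & content O <= outer_content A + e].
Proof.
move=> e0; have [_ [U [oU AU] <-] /ltW Ue] := inf_adherent e0 (has_inf_outer A).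
by exists U.
Qed.

Lemma outer_content_ge0 A : 0 <= outer_content A.
Proof. by apply: outer_content_glb => O _ _; exact: content_ge0. Qed.

Lemma le_outer_content A B : A `<=` B -> outer_content A <= outer_content B.
Proof.
move=> AB; apply: outer_content_glb => O oO BO; apply: outer_content_lb => //.
exact: subset_trans BO.
Qed.

Lemma outer_content_open O : open O -> outer_content O = content O.
Proof.
move=> oO; apply/eqP; rewrite eq_le outer_content_lb//=.
by apply: outer_content_glb => O' _; exact: le_content.
Qed.

(** Up to e, a function vanishing off the union lives on the closed set C where
    it is at least e. There it is dominated by a finite sum of functions
    vanishing off single sets O i, and the domination passes from X to s. *)
Lemma content_bigcup (O : nat -> set K) : (forall i, open (O i)) ->
  ((content (\bigcup_i O i))%:E <= \sum_(i <oo) (content (O i))%:E)%E.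
Proof.
move=> oO.
set S := limn _.
have partS N : ((\sum_(i < N) content (O i))%:E <= S)%E.
  rewrite -sumEFin -(big_mkord xpredT (fun i => (content (O i))%:E)).
  by apply: nneseries_lim_ge => i _; rewrite lee_fin content_ge0.
suff h a : vanishes_off (\bigcup_i O i) a -> ((ev a s)%:E <= S)%E.
  move: S h {partS} => [r| |] h.
  - by rewrite lee_fin; apply: content_lub => a /h; rewrite lee_fin.
  - exact: leey.
  - have := h pea0 (fun x _ _ => state0 x); by rewrite leeNy_eq.
move=> aO; apply/lee_addgt0Pr => e e0.
pose C := X `&` [set x | e <= ev a x].
have cC : closed C by exact: closed_extremal_ge.
have [||N [b [b0 b1]]] := ev_cover hE cC _ oO.
- exact: subIsetl.
- move=> x [Xx eax]; apply: contrapT => nOx.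
  by have := aO x Xx nOx; move: eax => /= ? ?; lra.
apply: le_trans (leeD2r _ (partS N)); rewrite -EFinD lee_fin.
apply: (@le_trans _ _ (\sum_(i < N) ev (b i) s + e)).
  apply: (@le_on_extremal _ _ (ev a) (fun x => \sum_(i < N) ev (b i) x + e)).
  - exact: affine_ev.
  - apply: affineD; last exact: affine_cst.
    by apply: affine_sum => i; exact: affine_ev.
  - move=> x Xx; have [xe|ex] := lerP e (ev a x).
      have := b1 x (conj Xx xe); have := state_le1 x a; lra.
    rewrite -[leLHS]add0r; apply: lerD; last exact: ltW.
    by apply: sumr_ge0 => i _; exact: state_ge0.
by rewrite lerD2r; apply: ler_sum => i _; apply: content_ub; exact: b0.
Qed.

(** Countable subadditivity depends on RDP2; its proof is an argument, so that
    the structure of outer measure can be attached to this function. *)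
Definition state_outer_measure (h : RDP2 E) (A : set K) : \bar R :=
  (outer_content A)%:E.

Local Notation mu := (state_outer_measure hE).

Let mu0 : mu set0 = 0%E.
Proof.
congr EFin; rewrite outer_content_open; last exact: open0.
by apply: content_eq0 => x _ [].
Qed.

Let mu_ge0 A : (0 <= mu A)%E.
Proof. by rewrite lee_fin outer_content_ge0. Qed.

Let le_mu : {homo mu : A B / A `<=` B >-> (A <= B)%E}.
Proof. by move=> A B AB; rewrite lee_fin; exact: le_outer_content. Qed.

Let mu_sigma_subadditive : sigma_subadditive mu.
Proof.
move=> F; apply/lee_addgt0Pr => e e0.
have /choice[ O hO] : forall i, exists O, [/\ open O, F i `<=` O &
    content O <= outer_content (F i) + e / (2 ^ i.+1)%:R].
  by move=> i; apply: outer_content_approx; rewrite divr_gt0// ltr0n expn_gt0.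
apply: le_trans (epsilon_trick xpredT _ (ltW e0)) => //.
apply: (@le_trans _ _ (content (\bigcup_i O i))%:E).
  rewrite lee_fin; apply: outer_content_lb.
    by apply: bigcup_open => i _; have [] := hO i.
  by apply: subset_bigcup => i _; have [] := hO i.
apply: le_trans (content_bigcup _) _; first by move=> i; have [] := hO i.
apply: lee_nneseries => [i _ _|i _]; first by rewrite lee_fin content_ge0.
by have [_ _] := hO i; rewrite -EFinD lee_fin.
Qed.

HB.instance Definition _ := isOuterMeasure.Build R K mu
  mu0 mu_ge0 le_mu mu_sigma_subadditive.

(** Let a be nearly optimal for the part of U inside O, and b for U minus the
    closed set C where a is at least e. Off C the function of a is below e, and
    on C that of b is 0, so the truncated sum of a and b loses at most e, and
    it vanishes off U. *)
Lemma content_setID U O : open U -> open O ->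
  content (U `&` O) + outer_content (U `&` ~` O) <= content U.
Proof.
move=> oU oO; rewrite -lerBrDr; apply: content_lub => a aUO.
rewrite lerBrDr; apply/ler_addgt0Pr => e e0.
rewrite -lerBrDl.
pose C := X `&` [set x | e <= ev a x].
have cC : closed C by exact: closed_extremal_ge.
apply: (@le_trans _ _ (content (U `&` ~` C))).
  apply: outer_content_lb; first by apply: openI => //; exact: closed_openC.
  move=> x [Ux nOx]; split=> // -[Xx /= eax].
  have : ev a x = 0 by apply: aUO => // -[].
  lra.
apply: content_lub => b bUC.
have [c hc] := ev_oplus R hE a b; rewrite -extremal_statesE// in hc.
have cU : ev c s <= content U.
  apply: content_ub => x Xx nUx.
  by rewrite hc// aUO ?bUC// ?addr0 ?min_r// => -[].
suff : ev a s + ev b s <= ev c s + e by lra.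
apply: (@le_on_extremal _ _ (fun x => ev a x + ev b x) (fun x => ev c x + e)).
- by apply: affineD; exact: affine_ev.
- by apply: affineD; [exact: affine_ev | exact: affine_cst].
move=> x Xx; rewrite hc//; have a1 := state_le1 x a; have b1 := state_le1 x b.
have [ab|ab] := lerP 1 (ev a x + ev b x); last lra.
have [xe|ex] := lerP e (ev a x); last lra.
by rewrite (bUC x)//; [lra|move=> [_]; apply; split].
Qed.

Lemma open_caratheodory O : open O -> mu.-caratheodory O.
Proof.
move=> oO; apply: le_caratheodory_measurable => Z.
rewrite /state_outer_measure -EFinD lee_fin.
apply: outer_content_glb => U oU ZU; apply: le_trans (content_setID oU oO).
apply: lerD; last by apply: le_outer_content; exact: setSI.
apply: outer_content_lb; first exact: openI.
exact: setSI.
Qed.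

Local Notation T := (borelType (state_space s)).

Lemma borel_caratheodory (A : set T) : measurable A -> mu.-caratheodory A.
Proof.
apply: smallest_sub; last by move=> O; exact: open_caratheodory.
exact: (@sigma_algebra_measurable _ (@caratheodory_type R (state_space s) mu)).
Qed.

(** A separate name lets the measure structure be inferred on Borel sets, next
    to the outer measure structure on all sets. *)
Definition state_measure (h : RDP2 E) (A : set T) : \bar R :=
  (outer_content A)%:E.

Local Notation smu := (state_measure hE).

Let smu0 : smu set0 = 0%E. Proof. exact: mu0. Qed.

Let smu_ge0 A : (0 <= smu A)%E. Proof. exact: mu_ge0. Qed.

Let smu_sigma_additive : semi_sigma_additive smu.
Proof.
move=> F mF tF mUF.
apply: (@caratheodory_measure_sigma_additive R (state_space s) mu) => //.
  by move=> i; exact: borel_caratheodory.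
exact: borel_caratheodory.
Qed.

HB.instance Definition _ := isMeasure.Build _ T R smu smu0 smu_ge0
  smu_sigma_additive.

Let smu_setT : smu setT = 1%E.
Proof.
congr EFin; rewrite outer_content_open; last exact: openT.
apply/eqP; rewrite eq_le; apply/andP; split.
  by apply: content_lub => a _; exact: state_le1.
by rewrite -(state1 s); apply: content_ub => x _ [].
Qed.

HB.instance Definition _ := Measure_isProbability.Build _ T R smu smu_setT.

Definition state_probability : probability T R := smu.

End RepresentingMeasure.

(** * The representing measure *)
Section Representation.
Variables (R : realType) (E : pseudoEffectAlgebraType).
Hypothesis hE : RDP2 E.
Variable s : state R E.
Implicit Types (a b c d : E) (x y z : state R E).
Local Notation ev := (@state_eval R E).
Local Notation X := (@extremal_states R E).
Local Notation T := (borelType (state_space s)).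
Local Notation mu := (state_probability hE s).

Lemma open_borel (O : set (state R E)) : open O -> measurable (O : set T).
Proof. by move=> oO; exact: sub_sigma_algebra. Qed.

Lemma closed_borel (C : set (state R E)) : closed C -> measurable (C : set T).
Proof.
move=> cC; rewrite -(setCK C); apply: measurableC; apply: open_borel.
exact: closed_openC.
Qed.

Lemma extremal_borel : measurable (X : set T).
Proof. by apply: closed_borel; exact: closed_extremal. Qed.

Lemma ev_measurable a (D : set T) : measurable D ->
  measurable_fun D (EFin \o (ev a : T -> R)).
Proof.
move=> mD; apply/measurable_EFinP.
apply: measurable_funS (@subsetT _ D) _ => //.
apply: (measurability _ (RGenOInfty.measurableE R)) => _ [_ [r ->] <-].
rewrite setTI; apply: open_borel.
have -> : ev a @^-1` `]r, +oo[%classic = ev a @^-1` [set t | r < t].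
  by apply/seteqP; split=> x /=; rewrite in_itv/= andbT.
apply: open_comp => [x _|]; first exact: ev_continuous.
exact: open_gt.
Qed.

Lemma state_probability_open (O : set (state R E)) : open O ->
  mu O = (content s O)%:E.
Proof. by move=> oO; congr EFin; exact: outer_content_open. Qed.

Lemma outer_contentC (A : set T) : measurable A ->
  outer_content s (~` A) = 1 - outer_content s A.
Proof. by move=> mA; have [] := probability_setC mu mA. Qed.

Lemma outer_content_extremal : outer_content s X = 1.
Proof.
suff : outer_content s (~` X) = 0.
  by rewrite outer_contentC; [lra | exact: extremal_borel].
rewrite outer_content_open; last first.
  by apply: closed_openC; exact: closed_extremal.
by apply: content_eq0 => x Xx; apply.
Qed.

Lemma state_probability_regular : regular_measure mu.
Proof.
move=> A mA; split; apply/eqP; rewrite eq_le; apply/andP; split.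
- apply/lee_addgt0Pr => e e0.
  have [U [oU AU Ue]] := outer_content_approx s A e0.
  apply: (@le_trans _ _ (mu U)); first by apply: ereal_inf_lbound; exists U.
  by rewrite state_probability_open// -EFinD lee_fin.
- apply: le_ereal_inf_tmp => _ [U [oU AU] <-].
  by rewrite lee_fin; exact: le_outer_content.
- apply: ge_ereal_sup => _ [C [cC CA] <-].
  by rewrite lee_fin; exact: le_outer_content.
apply/lee_addgt0Pr => e e0.
have [U [oU AU Ue]] := outer_content_approx s (~` A) e0.
apply: (@le_trans _ _ (mu (~` U) + e%:E)%E); last first.
  apply: leeD2r; apply: ereal_sup_ubound; exists (~` U) => //.
  by split; [exact: open_closedC | rewrite -[A]setCK; exact: subsetC].
rewrite -EFinD lee_fin (outer_contentC (open_borel oU)).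
have := outer_contentC mA; rewrite (outer_content_open s oU); lra.
Qed.

(** The left-hand side counts the integers k < N that are below t. *)
Lemma sum_indic_lt (t : R) N : 0 <= t ->
  \sum_(k < N) \1_[set u : R | k%:R < u] t <= t + 1.
Proof.
move=> t0; elim: N => [|N ih]; first by rewrite big_ord0; lra.
have [Nt|tN] := ltrP N%:R t.
  apply: (@le_trans _ _ N.+1%:R); last by rewrite -natr1; lra.
  rewrite -[N.+1 in leRHS]card_ord -sumr_const; apply: ler_sum => k _.
  by rewrite indicE; case: (_ \in _).
by rewrite big_ord_recr/= indicE memNset ?addr0//= ; apply/negP; rewrite -leNgt.
Qed.

(** On X, the function of N a is the sum over k < N of its slices, the
    truncations of N a - k; the k-th slice vanishes off the open set O k where
    N a > k. So N s(a) is at most the sum of the measures of the O k, which is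
    the integral of a function bounded by N a + 1. Dividing by N, the error 1 /
    N disappears in the limit. *)
Lemma state_le_integral a :
  ((ev a s)%:E <= \int[mu]_(x in X) (ev a x)%:E)%E.
Proof.
have mX := extremal_borel.
have I1 : (\int[mu]_(x in X) (ev a x)%:E <= 1%:E)%E.
  apply: (@le_trans _ _ (\int[mu]_(x in X) (cst 1%:E) x)%E).
    apply: ge0_le_integral => //.
    - by move=> x _; rewrite lee_fin state_ge0.
    - exact: ev_measurable.
    - by move=> x _; rewrite lee_fin state_le1.
  by rewrite integral_cst// mul1e probability_le1.
have I0 : (0 <= \int[mu]_(x in X) (ev a x)%:E)%E.
  by apply: integral_ge0 => x _; rewrite lee_fin state_ge0.
have key N : ((N%:R * ev a s)%:E <=
    N%:R%:E * \int[mu]_(x in X) (ev a x)%:E + 1)%E.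
  have /choice[g hg] := fun k => ev_clamp R hE a N k.
  pose O k := [set x : state R E | k%:R < N%:R * ev a x].
  have oO k : open (O k).
    have [cNa _] := affineZ N%:R (affine_ev R a).
    apply: (@open_comp _ _ (fun x => N%:R * ev a x) [set t | k%:R < t]).
      by move=> x _; exact: cNa.
    exact: open_gt.
  have gO k : ((ev (g k) s)%:E <= \int[mu]_(x in X) (\1_(O k) x)%:E)%E.
    rewrite integral_indic//; last exact: open_borel.
    apply: (@le_trans _ _ (mu (O k))).
      rewrite state_probability_open// lee_fin; apply: content_ub => x Xx.
      move=> /negP; rewrite -leNgt hg -?extremal_statesE// => h.
      by rewrite clamp_le0// subr_le0.
    (* the part of O k outside X is negligible *)
    have := le_outer_measureIC (state_outer_measure s hE) X (O k).
    rewrite !lee_fin => /le_trans; apply.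
    have : outer_content s (O k `&` ~` X) <= outer_content s (~` X).
      by apply: le_outer_content; exact: subIsetr.
    by rewrite (outer_contentC mX) outer_content_extremal; lra.
  apply: (@le_trans _ _ (\sum_(k < N) (ev (g k) s)%:E)%E).
    rewrite sumEFin lee_fin.
    apply: (@le_on_extremal _ _ (fun x => N%:R * ev a x)
                                (fun x => \sum_(k < N) ev (g k) x)).
    - exact/affineZ/affine_ev.
    - by apply: affine_sum => k; exact: affine_ev.
    - move=> x Xx.
      rewrite (eq_bigr (fun k : 'I_N => clamp (N%:R * ev a x - k%:R))).
        by rewrite sum_clamp// mulr_ge0 ?state_ge0//= ler_piMr ?state_le1.
      by move=> k _; rewrite hg -?extremal_statesE.
  apply: (@le_trans _ _ (\sum_(k < N) \int[mu]_(x in X) (\1_(O k) x)%:E)%E).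
    by apply: lee_sum => k _; exact: gO.
  have mO (k : nat) : measurable_fun (X : set T) (EFin \o (\1_(O k) : T -> R)).
    by apply/measurable_EFinP; apply: measurable_indic; exact: open_borel.
  have f0 (k : 'I_N) x : X x -> (0 <= (\1_(O k) x : R)%:E)%E.
    by move=> _; rewrite lee_fin.
  rewrite -(ge0_integral_sum mu mX (fun k : 'I_N => mO k) f0).
  have -> : (N%:R%:E * \int[mu]_(x in X) (ev a x)%:E + 1 =
      \int[mu]_(x in X) (N%:R%:E * (ev a x)%:E + (cst 1%:E) x))%E.
    rewrite ge0_integralD//.
    - rewrite ge0_integralZl//; last by move=> x _; rewrite lee_fin state_ge0.
        rewrite integral_cst// mul1e; congr (_ + _)%E.
        by congr EFin; rewrite outer_content_extremal.
      exact: ev_measurable.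
    - by move=> x _; rewrite -EFinM lee_fin mulr_ge0 ?state_ge0.
    - by apply: measurable_funeM; exact: ev_measurable.
  apply: ge0_le_integral => //.
  - by move=> x _; apply: sume_ge0 => k _; rewrite lee_fin.
  - by apply: emeasurable_sum => k; exact: mO.
  - apply: emeasurable_funD => //; apply: measurable_funeM.
    exact: ev_measurable.
  - move=> x _; rewrite sumEFin -EFinM -EFinD lee_fin.
    apply: le_trans (sum_indic_lt N _); last by rewrite mulr_ge0 ?state_ge0.
    by apply: ler_sum => k _; rewrite !indicE !(mem_setE, inE).
move: key I0 I1; case: (\int[mu]_(x in X) (ev a x)%:E)%E => [r| |] // key I0 I1.
have {}key N : N%:R * ev a s <= N%:R * r + 1.
  by have := key N; rewrite -EFinM -EFinD lee_fin.
rewrite lee_fin leNgt; apply/negP => rs.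
have d0 : 0 < ev a s - r by rewrite subr_gt0.
have := key (Num.truncn (ev a s - r)^-1).+1.
have : 1 < (Num.truncn (ev a s - r)^-1).+1%:R * (ev a s - r).
  by rewrite -ltr_pdivrMr// div1r truncnS_gt.
lra.
Qed.

(** The inequality for the complement of a is the reverse inequality for a. *)
Lemma state_eq_integral a :
  ((ev a s)%:E = \int[mu]_(x in X) (ev a x)%:E)%E.
Proof.
have mX := extremal_borel.
have [c hc] := ev_compl R a.
apply/eqP; rewrite eq_le state_le_integral/=.
have : (\int[mu]_(x in X) (ev a x)%:E + \int[mu]_(x in X) (ev c x)%:E = 1%:E)%E.
  rewrite -ge0_integralD//.
  - under eq_integral do rewrite -EFinD hc addrC subrK.
    by rewrite integral_cst// mul1e; congr EFin; exact: outer_content_extremal.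
  - by move=> x _; rewrite lee_fin state_ge0.
  - exact: ev_measurable.
  - by move=> x _; rewrite lee_fin state_ge0.
  - exact: ev_measurable.
have := state_le_integral c; have := state_le_integral a.
rewrite hc.
case: (\int[mu]_(x in X) (ev a x)%:E)%E => [r| |];
  case: (\int[mu]_(x in X) (ev c x)%:E)%E => [r'| |] //=.
by rewrite !lee_fin => ? ? []; lra.
Qed.

Lemma state_probability_represents : represents_state s mu.
Proof.
split.
- exact: state_probability_regular.
- exact: extremal_borel.
- by congr EFin; exact: outer_content_extremal.
- exact: state_eq_integral.
Qed.

(** A function vanishing off the open set U is at most 1 on U, so its integral
    is at most nu(U), which therefore bounds the content of U; outer regularity
    does the rest. *)
Lemma represents_state_ge (nu : probability T R) (A : set T) :
  represents_state s nu -> measurable A -> (mu A <= nu A)%E.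
Proof.
move=> [nureg mX _ nuI] mA; have [nuA _] := nureg _ mA; rewrite -nuA.
apply: le_ereal_inf_tmp => _ [U [oU AU] <-].
have mU := open_borel oU.
apply: (@le_trans _ _ (content s U)%:E).
  by rewrite lee_fin; exact: outer_content_lb.
have aU a : vanishes_off U a -> ((ev a s)%:E <= nu U)%E.
  move=> aU; rewrite nuI; apply: (@le_trans _ _ (nu (U `&` X))); last first.
    by apply: le_measure; rewrite ?inE//; exact: measurableI.
  rewrite -integral_indic//; apply: ge0_le_integral => //.
  - by move=> x _; rewrite lee_fin state_ge0.
  - exact: ev_measurable.
  - by apply/measurable_EFinP; apply: measurable_indic.
  - move=> x Xx; rewrite lee_fin indicE; case: (asboolP (U x)) => Ux.
      by rewrite mem_set// state_le1.
    by rewrite aU// ler0n.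
have fU : nu U \is a fin_num by exact: fin_num_measure.
suff : ((content s U)%:E <= nu U)%E by [].
rewrite -(fineK fU) lee_fin; apply: content_lub => a /aU.
by rewrite -(fineK fU) lee_fin.
Qed.

Lemma represents_state_unique (nu : probability T R) (A : set T) :
  represents_state s nu -> measurable A -> nu A = mu A.
Proof.
move=> rnu mA; apply/eqP; rewrite eq_le represents_state_ge// andbT.
have fA : nu A \is a fin_num by exact: fin_num_measure.
have := represents_state_ge rnu (measurableC mA).
rewrite !probability_setC// -(fineK fA) -[mu A]/((outer_content s A)%:E).
by rewrite -!EFinB !lee_fin; lra.
Qed.

End Representation.

Theorem theorem5p5 (R : realType) (E : pseudoEffectAlgebraType)
    (hE : RDP2 E) (s : state R E) :
  exists mu : probability (borelType (state_space s)) R,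
    represents_state s mu /\
    forall nu : probability (borelType (state_space s)) R,
      represents_state s nu ->
      forall Y : set (borelType (state_space s)), measurable Y -> nu Y = mu Y.
Proof.
exists (state_probability hE s); split.
  exact: state_probability_represents.
by move=> nu rnu Y mY; exact: represents_state_unique.
Qed.
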